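(* Let $q:\mathbb{R}^n\to\mathbb{R}\cup\{+\infty\}$ be proper, convex and lower semicontinuous. Then for every $(x,x^* )\in\mathrm{gph}\,\partial q$ there is a positive semidefinite $n\times n$ matrix $G$ with $\|G\|\le 1$ such that \[\{((I-G)v^*,\,Gv^* ) : v^*\in\mathbb{R}^n\}\subset \mathrm{gph}\, D^*(\partial q)(x,x^* ),\] i.e., $Gv^*\in D^*(\partial q)(x,x^* )((I-G)v^* )$ for every $v^*\in\mathbb{R}^n$.
   Context: $\partial q$ is the convex (Moreau–Rockafellar) subdifferential, viewed as a set-valued map $\mathbb{R}^n\rightrightarrows\mathbb{R}^n$; $\|G\|$ is the spectral norm. For a closed set $C$ and $\bar z\in C$: the regular normal cone $\widehat N_C(\bar z)$ is the polar of the tangent (contingent) cone $T_C(\bar z)=\{w:\exists t_k\downarrow0,w_k\to w,\ \bar z+t_kw_k\in C\}$, and the limiting normal cone $N_C(\bar z)$ consists of all limits $z^*=\lim z_k^*$ with $z_k^*\in\widehat N_C(z_k)$, $z_k\in C$, $z_k\to\bar z$. For a set-valued map $F$ with $(\bar x,\bar y)\in\mathrm{gph}\, F$, the limiting coderivative is $D^*F(\bar x,\bar y)(v^* )=\{u^*:(u^*,-v^* )\in N_{\mathrm{gph}\, F}(\bar x,\bar y)\}$, and $\mathrm{gph}\, D^*F(\bar x,\bar y)=\{(v^*,u^* ):u^*\in D^*F(\bar x,\bar y)(v^* )\}$. *)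

(* Defs.v *)
From HB Require Import structures.
From mathcomp Require Import all_boot all_order all_algebra.
From mathcomp Require Import all_classical all_reals.
Set Implicit Arguments. Unset Strict Implicit. Unset Printing Implicit Defensive.
Import Order.TTheory GRing.Theory Num.Theory.
Local Open Scope ring_scope.
Local Open Scope classical_set_scope.

Section Defs.
Variables (R : realType) (n : nat).
Notation V := 'cV[R]_n.

Definition dotv (u v : V) : R := \sum_(i < n) u i ord0 * v i ord0.
Definition enorm (u : V) : R := Num.sqrt (dotv u u).

Definition dot2 (z w : V * V) : R := dotv z.1 w.1 + dotv z.2 w.2.
Definition enorm2 (z : V * V) : R := Num.sqrt (dot2 z z).

Definition cvg_R (t : nat -> R) (a : R) : Prop :=
  forall e : R, 0 < e -> exists N : nat, forall k : nat, (N <= k)%N -> `|t k - a| < e.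
Definition cvg2 (z : nat -> V * V) (a : V * V) : Prop :=
  forall e : R, 0 < e -> exists N : nat, forall k : nat, (N <= k)%N ->
    enorm2 (z k - a) < e.

Definition tangent_cone (C : set (V * V)) (zb : V * V) : set (V * V) :=
  [set w | exists (t : nat -> R) (wk : nat -> V * V),
     (forall k, 0 < t k) /\ cvg_R t 0 /\ cvg2 wk w /\
     (forall k, C (zb + t k *: wk k))].
Definition regular_normal_cone (C : set (V * V)) (zb : V * V) : set (V * V) :=
  [set zs | forall w, tangent_cone C zb w -> dot2 zs w <= 0].
Definition limiting_normal_cone (C : set (V * V)) (zb : V * V) : set (V * V) :=
  [set zs | exists (zk zsk : nat -> V * V),
     (forall k, C (zk k)) /\ cvg2 zk zb /\
     (forall k, regular_normal_cone C (zk k) (zsk k)) /\ cvg2 zsk zs].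

Definition gph (F : V -> set V) : set (V * V) := [set z | F z.1 z.2].
Definition coderivative (F : V -> set V) (xb yb : V) (vs : V) : set V :=
  [set us | limiting_normal_cone (gph F) (xb, yb) (us, - vs)].

Definition proper_fun (q : V -> \bar R) : Prop :=
  (forall x, q x != -oo%E) /\ (exists x, q x != +oo%E).
Definition convex_fun (q : V -> \bar R) : Prop :=
  forall (x y : V) (t : R), 0 <= t <= 1 ->
    (q (t *: x + (1 - t) *: y)%R <= t%:E * q x + (1 - t)%R%:E * q y)%E.
Definition lsc_fun (q : V -> \bar R) : Prop :=
  forall (x : V) (a : R), (a%:E < q x)%E ->
    exists d : R, 0 < d /\ forall y, enorm (y - x) < d -> (a%:E < q y)%E.

Definition subdiff (q : V -> \bar R) (x : V) : set V :=
  [set xs | q x \is a fin_num /\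
     forall y, (q x + (dotv xs (y - x))%:E <= q y)%E].

Definition spectral_norm (G : 'M[R]_n) : R :=
  sup [set enorm (G *m v) | v in [set v : V | enorm v <= 1]].
Definition psd (G : 'M[R]_n) : Prop :=
  G^T = G /\ forall v : V, 0 <= dotv v (G *m v).

End Defs.

(* Main.v *)
Require Import Defs.
From HB Require Import structures.
From mathcomp Require Import all_boot all_order all_algebra.
From mathcomp Require Import all_classical all_reals.
From mathcomp Require Import ereal topology normedtype.
From mathcomp Require Import ring lra.
Import Order.TTheory GRing.Theory Num.Theory.
Import numFieldNormedType.Exports.
Local Open Scope ring_scope.
Local Open Scope classical_set_scope.

Set Implicit Arguments.
Unset Strict Implicit.
Unset Printing Implicit Defensive.

(** The resolvent [P = (I + dq)^-1] is everywhere defined, [gph dq] is the set of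
    pairs [(P z, z - P z)], and [P] is the gradient of a convex function [phi] with
    [0 <= phi (z + h) - phi z - <P z, h> <= |h|^2 / 2].  Instead of differentiating
    [P] almost everywhere (Rademacher), we blow [phi] up at [x + xs] and show that
    some pointwise limit of blow-ups is quadratic: the set of these limits is compact
    and stable under translations and dilations, so the curvature [2 f(e)] attains a
    maximum [L] over all limits [f] and unit vectors [e]; zooming in at [e / 2] gives
    a limit whose gradient is [t L e] on the whole line [R e], and cocoercivity then
    forces it to split off [L <., e> e].  Repeating this on the orthogonal complement
    yields a symmetric [0 <= B <= I] with [P (z + r w) = P z + r B w + o(r)] uniformly
    for [|w| <= 1], along some [z -> x + xs], [r -> 0].  Maximizing
    [<v, P y - B y> - m |y - z|^2] on the ball of radius [r] about such a [z] produces
    regular normals converging to [((I - B) v, - B v)], hence [G = I - B]. *)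

(** * Euclidean inner product and norm on column vectors *)

Section InnerProduct.
Variables (R : realType) (n : nat).
Implicit Types (u v w : 'cV[R]_n) (a : R).

Lemma dotvC u v : dotv u v = dotv v u.
Proof. by apply: eq_bigr => i _; rewrite mulrC. Qed.

Lemma dotvDl u v w : dotv (u + v) w = dotv u w + dotv v w.
Proof. by rewrite /dotv -big_split; apply: eq_bigr => i _; rewrite mxE mulrDl. Qed.

Lemma dotvZl a u w : dotv (a *: u) w = a * dotv u w.
Proof. by rewrite /dotv mulr_sumr; apply: eq_bigr => i _; rewrite mxE mulrA. Qed.

Lemma dotvNl u w : dotv (- u) w = - dotv u w.
Proof. by rewrite -scaleN1r dotvZl mulN1r. Qed.

Lemma dotv0l w : dotv 0 w = 0.
Proof. by rewrite -(scale0r w) dotvZl mul0r. Qed.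

Lemma dotvDr u v w : dotv w (u + v) = dotv w u + dotv w v.
Proof. by rewrite !(dotvC w) dotvDl. Qed.

Lemma dotvZr a u w : dotv w (a *: u) = a * dotv w u.
Proof. by rewrite !(dotvC w) dotvZl. Qed.

Lemma dotvNr u w : dotv w (- u) = - dotv w u.
Proof. by rewrite !(dotvC w) dotvNl. Qed.

Lemma dotv0r w : dotv w 0 = 0.
Proof. by rewrite dotvC dotv0l. Qed.

Definition dotvE := (dotvDl, dotvDr, dotvNl, dotvNr, dotvZl, dotvZr, dotv0l, dotv0r).

Lemma dotvvD u v : dotv (u + v) (u + v) = dotv u u + 2 * dotv u v + dotv v v.
Proof. by rewrite !dotvE (dotvC v u); ring. Qed.

Lemma dotvv_ge0 u : 0 <= dotv u u.
Proof. by apply: sumr_ge0 => i _; rewrite -expr2 sqr_ge0. Qed.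

Lemma dotvv_eq0 u : (dotv u u == 0) = (u == 0).
Proof.
apply/eqP/eqP => [|->]; last by rewrite dotv0l.
move=> /eqP; rewrite psumr_eq0 => [|i _]; last by rewrite -expr2 sqr_ge0.
move=> /allP u0; apply/colP => i; rewrite mxE.
by have := u0 i (mem_index_enum _); rewrite mulf_eq0 orbb => /eqP.
Qed.

Lemma dotv_inj u v : (forall w, dotv u w = dotv v w) -> u = v.
Proof.
move=> uv; apply/eqP; rewrite -subr_eq0 -dotvv_eq0 dotvDl dotvNl uv.
by rewrite subrr.
Qed.

Lemma dotv_mulmxl (A : 'M[R]_n) u v : dotv (A *m u) v = dotv u (A^T *m v).
Proof.
have dotvM x y : dotv x y = (x^T *m y) ord0 ord0.
  by rewrite mxE; apply: eq_bigr => i _; rewrite mxE.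
by rewrite !dotvM trmx_mul mulmxA.
Qed.

Lemma sqr_enorm u : enorm u ^+ 2 = dotv u u.
Proof. by rewrite sqr_sqrtr // dotvv_ge0. Qed.

Lemma enorm_ge0 u : 0 <= enorm u.
Proof. exact: sqrtr_ge0. Qed.

Lemma enorm0 : enorm (0 : 'cV[R]_n) = 0.
Proof. by rewrite /enorm dotv0l sqrtr0. Qed.

Lemma enormN u : enorm (- u) = enorm u.
Proof. by rewrite /enorm !dotvE opprK. Qed.

Lemma enormZ a u : enorm (a *: u) = `|a| * enorm u.
Proof. by rewrite /enorm !dotvE mulrA -expr2 sqrtrM ?sqr_ge0 // sqrtr_sqr. Qed.

Lemma enorm_le u a : 0 <= a -> (enorm u <= a) = (dotv u u <= a ^+ 2).
Proof. by move=> a0; rewrite -sqr_enorm ler_sqr // ?nnegrE ?enorm_ge0. Qed.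

Lemma enorm_lt u a : 0 <= a -> (enorm u < a) = (dotv u u < a ^+ 2).
Proof. by move=> a0; rewrite -sqr_enorm ltr_sqr // ?nnegrE ?enorm_ge0. Qed.

Lemma enorm_eq0 u : (enorm u == 0) = (u == 0).
Proof. by rewrite -dotvv_eq0 -sqr_enorm sqrf_eq0. Qed.

Lemma dotv_le_enorm u v : dotv u v <= enorm u * enorm v.
Proof.
have [/eqP|u0] := eqVneq (enorm u) 0.
  by rewrite enorm_eq0 => /eqP ->; rewrite enorm0 dotv0l mul0r.
have [/eqP|v0] := eqVneq (enorm v) 0.
  by rewrite enorm_eq0 => /eqP ->; rewrite enorm0 dotv0r mulr0.
have a0 : 0 < enorm u by rewrite lt_def u0 enorm_ge0.
have b0 : 0 < enorm v by rewrite lt_def v0 enorm_ge0.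
have := dotvv_ge0 (enorm v *: u - enorm u *: v).
rewrite !dotvE -!sqr_enorm (dotvC v u) => H.
have : 0 <= 2 * (enorm u * enorm v) * (enorm u * enorm v - dotv u v).
  by apply: le_trans H _; rewrite le_eqVlt; apply/orP; left; apply/eqP; ring.
by rewrite pmulr_rge0 ?subr_ge0 // !mulr_gt0.
Qed.

Lemma normr_dotv u v : `|dotv u v| <= enorm u * enorm v.
Proof.
rewrite ler_norml dotv_le_enorm andbT.
by have := dotv_le_enorm (- u) v; rewrite dotvNl enormN lerNl.
Qed.

Lemma enormD u v : enorm (u + v) <= enorm u + enorm v.
Proof.
rewrite enorm_le ?addr_ge0 ?enorm_ge0 // !dotvE (dotvC v u) -!sqr_enorm.
by have := dotv_le_enorm u v; lra.
Qed.

Lemma enormB_le u v : enorm (u - v) <= enorm u + enorm v.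
Proof. by rewrite -(enormN v) enormD. Qed.

Lemma enorm_distC u v : enorm (u - v) = enorm (v - u).
Proof. by rewrite -enormN opprB. Qed.

Lemma enorm_triangle w u v : enorm (u - v) <= enorm (u - w) + enorm (w - v).
Proof. by rewrite -{1}(subrK w u) -addrA enormD. Qed.

(** The topology on column vectors comes from the maximum norm; this bound and the converse one
    below let [enorm] describe neighbourhoods and bounded sets. *)
Lemma mx_norm_le_enorm u : `|u| <= enorm u.
Proof.
rewrite [leLHS]/Num.norm /= mx_normrE; apply/bigmax_leP; split=> [|[i j] _ /=].
  exact: enorm_ge0.
rewrite ord1 /enorm -sqrtr_sqr ler_wsqrtr // /dotv (bigD1 i) //= -expr2 lerDl.
by apply: sumr_ge0 => k _; rewrite -expr2 sqr_ge0.
Qed.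

Lemma enorm_le_mx_norm u : enorm u <= Num.sqrt n%:R * `|u|.
Proof.
rewrite enorm_le ?mulr_ge0 ?sqrtr_ge0 // exprMn sqr_sqrtr ?ler0n //.
have coord i : `|u i ord0| <= `|u|.
  rewrite [leRHS]/Num.norm /= mx_normrE.
  by apply: (le_bigmax _ (fun ij : 'I_n * 'I_1 => `|u ij.1 ij.2|) (i, ord0)).
apply: (@le_trans _ _ (\sum_(i < n) `|u| ^+ 2)).
  by apply: ler_sum => i _; rewrite -expr2 -[leLHS]real_normK ?num_real // ler_sqr ?nnegrE.
by rewrite sumr_const card_ord mulr_natl.
Qed.

End InnerProduct.

(** * Minima on compact sets, cluster points and closed conditions *)

Section Compactness.

(** Without a minimizer, the sublevel sets at real levels above the infimum generate a proper filter
    on [A]; around a cluster point, lower semicontinuity keeps [h] above one of these levels, a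
    contradiction. *)
Lemma compact_attains_min (R : realType) (T : topologicalType) (A : set T)
    (h : T -> \bar R) :
  compact A -> A !=set0 ->
  (forall x (a : R), A x -> (a%:E < h x)%E ->
     \forall y \near x, A y -> (a%:E < h y)%E) ->
  exists2 x, A x & forall y, A y -> (h x <= h y)%E.
Proof.
move=> cA [x0 Ax0] lsc; apply: contrapT => nmin.
have below x : A x -> exists2 y, A y & (h y < h x)%E.
  move=> Ax; apply: contrapT => nlt; apply: nmin; exists x => // y Ay.
  by rewrite leNgt; apply/negP => yx; apply: nlt; exists y.
pose m := ereal_inf (h @` A).
have m_lt x : A x -> (m < h x)%E.
  by move=> /below[y Ay]; apply: le_lt_trans; apply: ereal_inf_lbound; exists y.
have between x : A x -> exists2 a : R, (m < a%:E)%E & (a%:E < h x)%E.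
  move=> /m_lt; case: (m) (h x) => [a| |] [b| |] //.
  - by rewrite lte_fin => /midf_lt[? ?]; exists ((a + b) / 2); rewrite lte_fin.
  - by exists (a + 1); rewrite ?lte_fin ?ltrDl ?ltry.
  - by exists (b - 1); rewrite ?lte_fin ?gtrBl ?ltNyr.
  - by exists 0; rewrite ?ltry ?ltNyr.
pose G := filter_from [set a : R | (m < a%:E)%E]
  (fun a => [set y | A y /\ (h y <= a%:E)%E]).
have GF : ProperFilter G.
  apply: filter_from_proper; first apply: filter_from_filter.
  - by have [a ma _] := between _ Ax0; exists a.
  - move=> a b ma mb; exists (Num.min a b).
      by rewrite /= EFin_min lt_min ma mb.
    by move=> y /= [Ay]; rewrite EFin_min le_min => /andP[? ?].
  - move=> a ma; have /ereal_inf_lt[_ [y Ay <-] ya] : (m < a%:E)%E := ma.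
    by exists y; split => //; exact: ltW.
have GA : G A by have [a ma _] := between _ Ax0; exists a => // y [].
have [x [Ax Gx]] := cA G GF GA.
have [a ma ax] := between _ Ax.
have Ga : G [set y | A y /\ (h y <= a%:E)%E] by exists a.
have [y [[Ay ya] /(_ Ay) ay]] := Gx _ _ Ga (lsc x a Ax ax).
by move: (lt_le_trans ay ya); rewrite ltxx.
Qed.

Lemma cluster_sub_closed (T : topologicalType) (F : set_system T) (C : set T) :
  closed C -> F C -> cluster F `<=` C.
Proof.
by move=> clC FC x; rewrite clusterE => /(_ C FC); rewrite -(closure_id C).1.
Qed.

Lemma closed_cluster (T : topologicalType) (F : set_system T) :
  closed (cluster F).
Proof. by rewrite clusterE; apply: closed_bigI => A _; exact: closed_closure. Qed.

Lemma closed_ler_fun (R : realType) (T : topologicalType) (u v : T -> R) :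
  continuous u -> continuous v -> closed [set x | u x <= v x].
Proof.
move=> cu cv; rewrite (_ : mkset _ = (fun x => v x - u x) @^-1` [set t | 0 <= t]).
  apply: closed_comp; last exact: closed_ge.
  by move=> x _; apply: continuousB; [exact: cv | exact: cu].
by apply/seteqP; split => x /=; rewrite subr_ge0.
Qed.

Lemma closed_eqr_fun (R : realType) (T : topologicalType) (u v : T -> R) :
  continuous u -> continuous v -> closed [set x | u x = v x].
Proof.
move=> cu cv; rewrite (_ : mkset _ = [set x | u x <= v x] `&` [set x | v x <= u x]).
  by apply: closedI; exact: closed_ler_fun.
apply/seteqP; split => x /=; first by move=> ->.
by move=> [uv vu]; apply/eqP; rewrite eq_le uv.
Qed.

End Compactness.

(** * The Euclidean norm and the topology of column vectors *)

Section EuclideanTopology.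
Variables (R : realType) (n : nat).
Implicit Types (u v x : 'cV[R]_n).

Lemma near_enorm x (e : R) : 0 < e -> \forall y \near x, enorm (y - x) < e.
Proof.
move=> e0; have c0 : 0 < Num.sqrt n%:R + 1 :> R by rewrite ltr_wpDl ?sqrtr_ge0.
near=> y; apply: (le_lt_trans (enorm_le_mx_norm _)).
apply: (@le_lt_trans _ _ ((Num.sqrt n%:R + 1) * `|y - x|)).
  by rewrite ler_wpM2r // lerDl.
rewrite mulrC -ltr_pdivlMr // distrC; near: y.
by apply: (@cvgr_dist_lt _ _ _ (nbhs x) _ id x cvg_id); exact: divr_gt0.
Unshelve. all: by end_near. Qed.

Lemma near_dist_enorm x (P : set 'cV[R]_n) (e : R) :
  0 < e -> (forall y, enorm (y - x) < e -> P y) -> \forall y \near x, P y.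
Proof. by move=> e0 eP; apply: filterS (near_enorm x e0) => y; exact: eP. Qed.

Lemma dotv_continuous v : continuous (fun u => dotv u v).
Proof.
move=> u; apply: (iffRL (@cvgrPdist_lt _ _ _ (nbhs u) _ _ _)) => e e0.
have c0 : 0 < enorm v + 1 by rewrite ltr_wpDl ?enorm_ge0.
apply: (@near_dist_enorm _ _ (e / (enorm v + 1))); first exact: divr_gt0.
move=> y; rewrite ltr_pdivlMr // => yu.
rewrite -dotvNl -dotvDl (le_lt_trans (normr_dotv _ _)) //.
rewrite enorm_distC (le_lt_trans _ yu) // ler_wpM2l ?enorm_ge0 //.
by rewrite lerDl.
Qed.

Lemma enorm_continuous : continuous (@enorm R n).
Proof.
move=> u; apply: (iffRL (@cvgrPdist_lt _ _ _ (nbhs u) _ _ _)) => e e0; apply: (near_dist_enorm e0) => y yu.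
apply: le_lt_trans yu; rewrite ler_norml lerNl opprB.
have := enormD (y - u) u; have := enormD (u - y) y.
by rewrite !subrK enorm_distC; lra.
Qed.

Lemma compact_cball (r : R) : compact [set x : 'cV[R]_n | enorm x <= r].
Proof.
have clB : closed [set x : 'cV[R]_n | enorm x <= r].
  by apply: closed_ler_fun; [exact: enorm_continuous | exact: cst_continuous].
pose B := [set y : 'rV[R]_n | forall i, `[- r, r]%classic (y ord0 i)].
have cB : compact B.
  by apply: (@rV_compact _ _ (fun=> `[- r, r]%classic)) => i; exact: segment_compact.
have ctr : continuous (trmx : 'rV[R]_n -> 'cV[R]_n).
  move=> y; apply: (iffRL (@cvg_ballP _ _ _ (nbhs y) _ _ _)) => e e0; near=> z.
  split=> // i j; rewrite !mxE.
  have [_] : ball y e z by near: z; exact: nbhsx_ballx.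
  exact.
have cI := continuous_compact (continuous_subspaceT ctr) cB.
apply: (subclosed_compact clB cI) => x /= xr; exists x^T; last by rewrite trmxK.
move=> i /=; rewrite in_itv /= -ler_norml mxE (le_trans _ xr) //.
apply: le_trans (mx_norm_le_enorm x).
rewrite [leRHS]/Num.norm /= mx_normrE.
by apply: (le_bigmax _ (fun ij : 'I_n * 'I_1 => `|x ij.1 ij.2|) (i, ord0)).
Unshelve. all: by end_near. Qed.

End EuclideanTopology.

(** * Convex functions with Lipschitz gradient *)

Section SmoothConvex.
Variables (R : realType) (n : nat).
Notation V := 'cV[R]_n.
Implicit Types (f g : V -> R) (p q : V -> V) (L : R).

(* [f] is convex and differentiable with gradient [p], which is [L]-Lipschitz. *)
Definition convex_smooth L f p :=
  forall x h : V, 0 <= f (x + h) - f x - dotv (p x) h <= L / 2 * dotv h h.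

(** Subtracting [f] from [L / 2 |x|^2] exchanges the two bounds. *)
Lemma convex_smooth_compl L f p : convex_smooth L f p ->
  convex_smooth L (fun x => L / 2 * dotv x x - f x) (fun x => L *: x - p x).
Proof.
move=> fp x h; have := fp x h; rewrite !dotvE (dotvC h x) => /andP[lo up].
by apply/andP; split; lra.
Qed.

Lemma quadratic_bound_eq0 (a c : R) : (forall t, t * a <= c) -> a = 0.
Proof.
move=> ac; apply/eqP; apply: contraT => a0.
by have := ac ((c + 1) / a); rewrite divfK //; lra.
Qed.

(** Baillon-Haddad inequality. The value of [f] after a step from [y] along [p x - p y] is bounded
    above by smoothness at [y] and below by convexity at [x]; adding the estimate with [x] and [y]
    exchanged eliminates [f]. *)
Lemma convex_smooth_cocoercive L f p : 0 <= L -> convex_smooth L f p ->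
  forall x y, dotv (p y - p x) (p y - p x) <= L * dotv (p y - p x) (y - x).
Proof.
move=> L0 fp.
have half x y t : (t - L / 2 * t ^+ 2) * dotv (p y - p x) (p y - p x)
    <= f y - f x - dotv (p x) (y - x).
  have /andP[lo _] := fp x ((y - x) - t *: (p y - p x)).
  have /andP[_ up] := fp y (- (t *: (p y - p x))).
  have E : x + (y - x - t *: (p y - p x)) = y - t *: (p y - p x).
    by rewrite addrA addrCA subrr addr0.
  move: lo up; rewrite E !dotvE (dotvC (p y) (p x)) => lo up; lra.
move=> x y; set Q := dotv _ _; set D := dotv _ _.
have tot t : (t * 2 - L * t ^+ 2) * Q <= D.
  have h1 := half x y t; have h2 := half y x t.
  move: h1 h2; rewrite /Q /D !dotvE (dotvC (p x) (p y)) => h1 h2; lra.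
(* For [L = 0] the bound is linear in [t] and forces [Q = 0]; otherwise [t = 1 / L] is optimal. *)
have [L_0|Lneq0] := eqVneq L 0.
  rewrite L_0 mul0r (@quadratic_bound_eq0 Q D) // => t.
  by have := tot (t / 2); rewrite L_0; lra.
have Lgt0 : 0 < L by rewrite lt_def Lneq0.
have := tot L^-1; rewrite -(ler_pM2l Lgt0); apply: le_trans.
by rewrite le_eqVlt; apply/orP; left; apply/eqP; field.
Qed.

(** A gradient step from [x] would push [f] below zero unless the gradient vanishes; the step length
    [1 / (L + 1)] also covers [L = 0]. *)
Lemma convex_smooth_min L f p x : 0 <= L -> convex_smooth L f p ->
  (forall y, 0 <= f y) -> f x = 0 -> p x = 0.
Proof.
move=> L0 fp f0 fx; apply/eqP; rewrite -dotvv_eq0 eq_le dotvv_ge0 andbT.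
have L1 : 0 < L + 1 by lra.
have := fp x (- ((L + 1)^-1 *: p x)); rewrite fx !dotvE subr0 => /andP[_].
have := f0 (x - (L + 1)^-1 *: p x); set Q := dotv _ _; set t := (L + 1)^-1.
move=> f0' le.
have t0 : 0 < t by rewrite invr_gt0.
have Lt : L * t = 1 - t by rewrite /t; field; rewrite gt_eqF.
have : t * ((1 + t) * Q) <= 0.
  have -> : t * ((1 + t) * Q) = 2 * (t * Q) - (L * t) * (t * Q) by rewrite Lt; ring.
  lra.
by rewrite pmulr_rle0 // pmulr_rle0 //; lra.
Qed.

(** The complement [g = L / 2 |x|^2 - f] is nonnegative, convex and zero at [0] and [e], hence zero
    on the segment between them, where its gradient therefore vanishes. *)
Lemma convex_smooth_segment L f p e : 0 <= L -> convex_smooth L f p ->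
  f 0 = 0 -> p 0 = 0 -> dotv e e = 1 -> f e = L / 2 ->
  forall t, 0 <= t <= 1 -> p (t *: e) = (t * L) *: e.
Proof.
move=> L0 fp f0 p0 e1 fe t /andP[t0 t1].
have gq := convex_smooth_compl fp.
set g := fun x => _ in gq; set q := fun x => _ in gq.
have g0 y : 0 <= g y.
  by have /andP[_] := fp 0 y; rewrite add0r f0 p0 !dotvE /g; lra.
suff : q (t *: e) = 0.
  by rewrite /q => /eqP; rewrite subr_eq0 scalerA mulrC => /eqP.
apply: (convex_smooth_min L0 gq g0); apply/eqP; rewrite eq_le g0 andbT.
have /andP[lo0 _] := gq (t *: e) (- (t *: e)).
have /andP[lo1 _] := gq (t *: e) ((1 - t) *: e).
have g00 : g 0 = 0 by rewrite /g dotv0l f0; ring.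
have ge0 : g e = 0 by rewrite /g e1 fe; ring.
move: lo0 lo1; rewrite subrr -scalerDl (_ : t + (1 - t) = 1); last by ring.
rewrite scale1r g00 ge0 !dotvNr !dotvZr; set d := dotv _ _ => lo0 lo1.
have := mulr_ge0 (_ : 0 <= 1 - t) lo0; have := mulr_ge0 t0 lo1.
by rewrite subr_ge0 => h1 /(_ t1); lra.
Qed.

(** In cocoercivity between [x] and [- t e] the terms in [t^2] cancel, and the remaining linear
    bound in [t] gives the first identity. With it, cocoercivity between [x] and [x + s e] makes
    [|p (x + s e) - p x - s L e|^2] nonpositive. *)
Lemma convex_smooth_line L f p e : 0 <= L -> convex_smooth L f p ->
  dotv e e = 1 -> (forall t, p (t *: e) = (t * L) *: e) ->
  (forall x, dotv (p x) e = L * dotv x e) /\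
  (forall x s, p (x + s *: e) = p x + (s * L) *: e).
Proof.
move=> L0 fp e1 pe; have coco := convex_smooth_cocoercive L0 fp.
have dot_pe x : dotv (p x) e = L * dotv x e.
  apply/eqP; rewrite -subr_eq0; apply/eqP.
  suff [c cP] : exists c, forall t, t * (L * (dotv (p x) e - L * dotv x e)) <= c.
    have [L_0|Ln0] := eqVneq L 0; last first.
      have := quadratic_bound_eq0 cP.
      by move/eqP; rewrite mulf_eq0 (negPf Ln0) => /eqP.
    have := coco 0 x; have := pe 0; rewrite scale0r mul0r scale0r => -> .
    rewrite !subr0 L_0 !mul0r => H; suff -> : p x = 0 by rewrite dotv0l subr0.
    by apply/eqP; rewrite -dotvv_eq0 eq_le H dotvv_ge0.
  exists (L * dotv (p x) x - dotv (p x) (p x)) => t.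
  have := coco (- t *: e) x; rewrite pe !dotvE e1 (dotvC e) (dotvC e x) => H.
  lra.
split=> // x s; apply/eqP; rewrite -subr_eq0 -dotvv_eq0 eq_le dotvv_ge0 andbT.
have := coco x (x + s *: e); have := dot_pe (x + s *: e); have := dot_pe x.
set y := p (x + _).
rewrite !dotvE e1 !(dotvC e) !(dotvC (p x) y) => Hx Hy; rewrite ?Hx ?Hy => H.
lra.
Qed.

End SmoothConvex.

(** * Continuity of differences and multiples *)

Section ContinuousFunctions.
Variables (R : realType) (T : topologicalType) (W : normedModType R).

Lemma continuous_subr (f g : T -> W) :
  continuous f -> continuous g -> continuous (fun t => f t - g t).
Proof. by move=> cf cg t; apply: cvgB; [exact: cf | exact: cg]. Qed.

Lemma continuous_scaler (a : R) (f : T -> W) :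
  continuous f -> continuous (fun t => a *: f t).
Proof. by move=> cf t; apply: cvgZr; exact: cf. Qed.

End ContinuousFunctions.

(** * Blow-ups of a function and their continuity *)

Section Zoom.
Variables (R : realType) (n : nat).
Notation V := 'cV[R]_n.

(* A function paired with its gradient; both carry the topology of pointwise convergence. *)
Definition jet : Type := ({ptws V -> R} * {ptws V -> V})%type.
HB.instance Definition _ := Topological.on jet.

Implicit Types (F : jet) (x z : V) (r s : R).

(** Second-order blow-up at [x]: the first-order Taylor polynomial is removed, and the powers of [s]
    preserve the Lipschitz constant of the gradient. *)
Definition zoom x s F : jet :=
  (fun w => s^-1 ^+ 2 * (F.1 (x + s *: w) - F.1 x - s * dotv (F.2 x) w),
   fun w => s^-1 *: (F.2 (x + s *: w) - F.2 x)).

Definition normalized F :=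
  [/\ convex_smooth 1 F.1 F.2, F.1 0 = 0 & F.2 0 = 0].

Lemma zoom_convex_smooth L x s F : 0 < s ->
  convex_smooth L F.1 F.2 -> convex_smooth L (zoom x s F).1 (zoom x s F).2.
Proof.
move=> s0 Fs y h /=; have := Fs (x + s *: y) (s *: h).
rewrite scalerDr addrA; set a := F.1 _; set b := F.1 _; set c := F.1 _.
set u := F.2 _; set v := F.2 _; rewrite !dotvE.
set d := dotv u h; set d1 := dotv v h; set d2 := dotv v y; set hh := dotv h h.
have sn : s != 0 by rewrite gt_eqF.
have -> : s^-1 ^+ 2 * (a - c - s * (d2 + d1)) - s^-1 ^+ 2 * (b - c - s * d2)
    - s^-1 * (d - d1) = s^-1 ^+ 2 * (a - b - s * d) by field.
have s2 : 0 < s^-1 ^+ 2 by rewrite exprn_gt0 // invr_gt0.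
move=> /andP[lo up]; rewrite mulr_ge0 ?(ltW s2) //=.
rewrite (_ : L / 2 * hh = s^-1 ^+ 2 * (L / 2 * (s * (s * hh)))); last by field.
by rewrite ler_pM2l.
Qed.

Lemma zoom_normalized x s F : 0 < s ->
  convex_smooth 1 F.1 F.2 -> normalized (zoom x s F).
Proof.
move=> s0 Fs; split; first exact: zoom_convex_smooth.
  by rewrite /= scaler0 addr0 subrr dotv0r mulr0 subr0 mulr0.
by rewrite /= scaler0 addr0 subrr scaler0.
Qed.

(** This composition rule makes limits of zooms stable under further zooming. *)
Lemma zoom_zoom x s z r F : r != 0 -> s != 0 ->
  zoom x s (zoom z r F) = zoom (z + r *: x) (r * s) F.
Proof.
move=> r0 s0; rewrite /zoom /=; congr (_, _); apply/funext => w.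
  rewrite !dotvE scalerDr addrA scalerA; field.
  by rewrite r0 s0.
rewrite -scalerBr scalerA opprB addrA subrK [r *: _]scalerDr addrA !scalerA.
by congr (_ *: _); rewrite invfM mulrC.
Qed.

Lemma jet_value_continuous x : continuous (fun F => F.1 x).
Proof.
move=> F; apply: (@continuous_comp _ _ _ (fst : jet -> _) (fun f : {ptws V -> R} => f x)).
  exact: cvg_fst.
exact: (@proj_continuous V (fun=> R) x).
Qed.

Lemma jet_gradient_continuous x : continuous (fun F => F.2 x).
Proof.
move=> F; apply: (@continuous_comp _ _ _ (snd : jet -> _) (fun f : {ptws V -> V} => f x)).
  exact: cvg_snd.
exact: (@proj_continuous V (fun=> V) x).
Qed.

Lemma jet_dotv_continuous x w : continuous (fun F => dotv (F.2 x) w).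
Proof.
move=> F; apply: (@continuous_comp _ _ _ (fun F : jet => F.2 x) (fun u => dotv u w)).
  exact: jet_gradient_continuous.
exact: dotv_continuous.
Qed.

Lemma continuous_ptws (T : topologicalType) (W : uniformType) (g : T -> V -> W) :
  (forall w, continuous (fun t => g t w)) ->
  continuous (g : T -> {ptws V -> W}).
Proof.
move=> cg t.
apply: (iffRL (@pointwise_cvgP V W _ (g t) (fmap_filter _ _))) => w.
exact: cg.
Qed.

Lemma zoom_value_continuous x s w : continuous (fun F => (zoom x s F).1 w).
Proof.
have cx := @jet_value_continuous x; have cxw := @jet_value_continuous (x + s *: w).
have cd := @jet_dotv_continuous x w.
have c1 := @continuous_subr R jet R^o _ _ cxw cx.
have c2 := @continuous_scaler R jet R^o s _ cd.
have c3 := @continuous_subr R jet R^o _ _ c1 c2.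
exact: (@continuous_scaler R jet R^o (s^-1 ^+ 2) _ c3).
Qed.

Lemma zoom_gradient_continuous x s w : continuous (fun F => (zoom x s F).2 w).
Proof.
have cx := @jet_gradient_continuous x; have cxw := @jet_gradient_continuous (x + s *: w).
have c1 := @continuous_subr R jet V _ _ cxw cx.
exact: (@continuous_scaler R jet V s^-1 _ c1).
Qed.

(** Each value of a zoom uses finitely many evaluations of the jet, so pointwise convergence is
    enough. *)
Lemma zoom_continuous x s : continuous (zoom x s).
Proof.
move=> F.
have c1 := @continuous_ptws _ _ (fun F => (zoom x s F).1) (@zoom_value_continuous x s).
have c2 := @continuous_ptws _ _ (fun F => (zoom x s F).2) (@zoom_gradient_continuous x s).
exact: (cvg_pair (c1 F) (c2 F)).
Qed.

End Zoom.

(** * Zoom-stable families contain a jet with linear gradient *)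

Section ZoomFamilies.
Variables (R : realType) (n : nat).
Notation V := 'cV[R]_n.
Notation jet := (jet R n).
Implicit Types (F G : jet) (K : set jet) (x h e w : V) (P B : 'M[R]_n) (L s t : R).

(** Abstracts what the peeling argument needs from the set of blow-up limits. *)
Definition zoom_family K :=
  [/\ closed K, K !=set0, K `<=` @normalized R n &
      forall F x s, K F -> 0 < s -> K (zoom x s F)].

Lemma normalized_value F x : normalized F -> 0 <= F.1 x <= 1 / 2 * dotv x x.
Proof.
by case=> Fs F0 p0; have := Fs 0 x; rewrite add0r F0 p0 dotv0l !subr0.
Qed.

Lemma normalized_lipschitz F x y : normalized F ->
  enorm (F.2 y - F.2 x) <= enorm (y - x).
Proof.
case=> Fs _ _; have := convex_smooth_cocoercive ler01 Fs x y.
rewrite mul1r => H; have := le_trans H (dotv_le_enorm _ _).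
have [-> _|n0] := eqVneq (enorm (F.2 y - F.2 x)) 0; first exact: enorm_ge0.
by rewrite -sqr_enorm expr2 ler_pM2l // lt_def n0 enorm_ge0.
Qed.

Lemma normalized_gradient F x : normalized F -> enorm (F.2 x) <= enorm x.
Proof.
by move=> FN; have := normalized_lipschitz 0 x FN; case: FN => _ _ ->; rewrite !subr0.
Qed.

(** Values at [x] stay in [[0, |x|^2 / 2]] and gradients in the ball of radius [|x|], so Tychonoff
    applies in the pointwise topology. *)
Lemma compact_sub_normalized K : closed K -> K `<=` @normalized R n -> compact K.
Proof.
move=> clK KN.
pose box1 := [set f : {ptws V -> R} | forall x, `[0, 1 / 2 * dotv x x]%classic (f x)].
pose box2 := [set p : {ptws V -> V} | forall x, [set u | enorm u <= enorm x] (p x)].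
have c1 : compact box1.
  by apply: (@tychonoff V (fun=> R) (fun x => `[0, 1 / 2 * dotv x x]%classic)) => x;
     exact: segment_compact.
have c2 : compact box2.
  by apply: (@tychonoff V (fun=> V) (fun x => [set u | enorm u <= enorm x])) => x;
     exact: compact_cball.
apply: (subclosed_compact clK (compact_setX c1 c2)) => F /KN FN; split => x /=.
  by rewrite in_itv /=; exact: normalized_value.
exact: normalized_gradient.
Qed.

Lemma closed_unit_fixed P : closed [set e : V | enorm e = 1 /\ P *m e = e].
Proof.
rewrite (_ : mkset _ = [set e | enorm e = 1] `&`
    \bigcap_(w in [set: V]) [set e | dotv e (P^T *m w) = dotv e w]).
  apply: closedI.
    by apply: closed_eqr_fun; [exact: enorm_continuous | exact: cst_continuous].
  by apply: closed_bigI => w _; apply: closed_eqr_fun; exact: dotv_continuous.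
apply/seteqP; split => e /= [e1 Pe]; split => //.
  by move=> w _ /=; rewrite -dotv_mulmxl Pe.
by apply: dotv_inj => w; rewrite dotv_mulmxl; exact: Pe.
Qed.

Lemma enorm_eq1 e : (enorm e = 1) <-> (dotv e e = 1).
Proof.
split=> [e1|e1]; first by rewrite -sqr_enorm e1 expr1n.
by rewrite /enorm e1 sqrtr1.
Qed.

Lemma unit_fixed_exists P : P *m P = P -> P != 0 ->
  exists e, enorm e = 1 /\ P *m e = e.
Proof.
move=> PP Pn0; have [w wP] : exists w, P *m w != 0.
  apply: contrapT => noP; move/negP: Pn0; apply; apply/eqP/matrixP => i j.
  have /eqP : P *m (delta_mx j ord0 : V) = 0.
    by apply/eqP; apply: contrapT => /negP H; apply: noP; eexists; exact: H.
  by rewrite -colE => /eqP/colP/(_ i); rewrite !mxE.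
exists ((enorm (P *m w))^-1 *: (P *m w)); split; last by rewrite -scalemxAr mulmxA PP.
by rewrite enormZ ger0_norm ?invr_ge0 ?enorm_ge0 // mulVf // enorm_eq0.
Qed.

Lemma family_value_scale F s w : normalized F -> s != 0 ->
  F.1 (s *: w) = s ^+ 2 * (zoom 0 s F).1 w.
Proof.
case=> _ F0 p0 sn /=; rewrite add0r F0 p0 dotv0l mulr0 !subr0 mulrA -exprMn.
by rewrite divff // expr1n mul1r.
Qed.

Lemma near_jet_value F x (eps : R) : 0 < eps ->
  \forall G \near F, `|F.1 x - G.1 x| < eps.
Proof. by move=> e0; have /cvgrPdist_lt := @jet_value_continuous _ _ x F; exact. Qed.

(** Evaluation attains its maximum over the compact set of pairs of a jet in [K] and a unit vector
    fixed by [P]; zooming at the origin with scale [|h|] carries the bound over to every fixed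
    [h]. *)
Lemma family_max_curvature K P : zoom_family K -> P *m P = P -> P != 0 ->
  exists F e L, [/\ K F, dotv e e = 1, P *m e = e, 0 <= L & F.1 e = L / 2] /\
    forall G h, K G -> P *m h = h -> G.1 h <= L / 2 * dotv h h.
Proof.
move=> [clK [F0 KF0] KN Kz] PP Pn0.
have [e0 [e01 Pe0]] := unit_fixed_exists PP Pn0.
pose S := [set e : V | enorm e = 1 /\ P *m e = e].
have cS : compact S.
  apply: (subclosed_compact (@closed_unit_fixed P) (@compact_cball R n 1)).
  by move=> e [e1 _]; rewrite /= e1.
have cA := compact_setX (compact_sub_normalized clK KN) cS.
have A0 : (K `*` S) !=set0 by exists (F0, e0).
have := compact_attains_min (h := fun z : jet * V => (- z.1.1 z.2)%:E) cA A0.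
case=> [|[F e] [/= KF [e1 Pe]] Fmin].
  move=> [F e] a [/= KF [e1 Pe]]; rewrite lte_fin => aF.
  (* Smoothness bounds [G.1 e' - G.1 e] by [r + r^2 / 2] with [r = |e' - e|], uniformly in [G], so
     evaluation is jointly semicontinuous. *)
  pose d := - F.1 e - a; have d0 : 0 < d by rewrite /d; lra.
  have d1 : 0 < Num.min (d / 4) 1 by rewrite lt_min ltr01 andbT; lra.
  exists ([set G | `|F.1 e - G.1 e| < d / 2],
          [set e' | enorm (e' - e) < Num.min (d / 4) 1]).
    by split; [apply: near_jet_value; lra | exact: near_enorm].
  move=> [G e'] [/= Ge e'e] [KG [e'1 Pe']].
  rewrite lte_fin; have [Gs _ _] := KN _ KG.
  have /andP[_] := Gs e (e' - e); rewrite (addrC e) subrK -sqr_enorm.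
  have := dotv_le_enorm (G.2 e) (e' - e).
  have := normalized_gradient e (KN _ KG); rewrite e1.
  move: e'e; rewrite lt_min; have := enorm_ge0 (e' - e).
  set r := enorm (e' - e) => r0 /andP[rd r1] Ge1 cs up.
  have r2 : r ^+ 2 <= r by rewrite expr2 ler_piMr // ltW.
  have gr : enorm (G.2 e) * r <= r by rewrite ler_piMl.
  by move: Ge; rewrite ltr_norml /d in rd * => /andP[? ?]; lra.
exists F, e, (2 * F.1 e); split.
  have /andP[Fe0 _] := normalized_value e (KN _ KF).
  by split=> //; [exact/enorm_eq1 | lra | lra].
move=> G h KG Ph; have [->|h0] := eqVneq h 0.
  by have [_ -> _] := KN _ KG; rewrite dotv0l mulr0.
have hn : enorm h != 0 by rewrite enorm_eq0.
have hpos : 0 < enorm h by rewrite lt_def hn enorm_ge0.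
have := Fmin (zoom 0 (enorm h) G, (enorm h)^-1 *: h); rewrite lee_fin lerN2 => H.
have hh : h = enorm h *: ((enorm h)^-1 *: h) by rewrite scalerA divff // scale1r.
rewrite [in leLHS]hh (family_value_scale _ (KN _ KG) hn).
rewrite -sqr_enorm [leRHS]mulrC ler_pM2l ?exprn_gt0 //.
rewrite (le_trans (H _)) //; last lra.
split; first exact: Kz.
split => /=; last by rewrite -scalemxAr Ph.
by rewrite enormZ ger0_norm ?invr_ge0 ?enorm_ge0 // mulVf.
Qed.

(** The zoom of [F] at [P x] with scale [1] lies in [K], and its value at [P h] is the Taylor
    remainder of [F]; so the bound at the origin holds at every base point. *)
Lemma projection_convex_smooth K P L F : zoom_family K -> P^T = P -> P *m P = P ->
  0 <= L -> (forall G h, K G -> P *m h = h -> G.1 h <= L / 2 * dotv h h) -> K F ->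
  convex_smooth L (fun x => F.1 (P *m x)) (fun x => P *m F.2 (P *m x)).
Proof.
move=> [_ _ KN Kz] Pt PP L0 KL KF x h /=.
have KZ := Kz F (P *m x) 1 KF ltr01.
have /andP[lo _] := normalized_value (P *m h) (KN _ KZ).
have := KL _ (P *m h) KZ; rewrite mulmxA PP => /(_ erefl).
rewrite (dotv_mulmxl P (F.2 _)) Pt mulmxDr.
move: lo; rewrite /= invr1 expr1n !mul1r scale1r => -> /= up.
apply: (le_trans up); rewrite ler_wpM2l ?divr_ge0 //.
have PhPh : dotv (P *m h) (P *m h) = dotv (P *m h) h.
  by rewrite dotv_mulmxl Pt mulmxA PP dotvC.
by have := dotvv_ge0 (h - P *m h); rewrite !dotvE (dotvC h) PhPh; lra.
Qed.

(** State of the peeling: [B] collects the curvature already extracted, while the rest of the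
    gradient lives on the range of [P]. *)
Definition splits P B F := forall x, F.2 x = B *m x + P *m F.2 (P *m x).

Lemma closed_splits P B : closed (splits P B).
Proof.
rewrite (_ : splits P B = \bigcap_(xw in [set: V * V])
    [set F | dotv (F.2 xw.1) xw.2 - dotv (F.2 (P *m xw.1)) (P^T *m xw.2)
             = dotv (B *m xw.1) xw.2]).
  apply: closed_bigI => -[x w] _ /=; apply: closed_eqr_fun; last exact: cst_continuous.
  apply: (@continuous_subr R jet R^o (fun F => dotv (F.2 x) w)
    (fun F => dotv (F.2 (P *m x)) (P^T *m w))); exact: jet_dotv_continuous.
apply/seteqP; split => F.
  by move=> FPB [x w] _ /=; rewrite FPB dotvDl (dotv_mulmxl P); ring.
move=> FPB x; apply: dotv_inj => w; have := FPB (x, w) I => /=.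
by rewrite dotvDl (dotv_mulmxl P) => <-; rewrite subrK.
Qed.

Lemma zoom_splits P B F x s : P *m P = P -> P *m B = 0 -> s != 0 ->
  splits P B F -> splits P B (zoom x s F).
Proof.
move=> PP PB sn FPB y /=.
have PF u : P *m F.2 u = P *m F.2 (P *m u).
  by rewrite FPB mulmxDr !mulmxA PB PP mul0mx add0r.
rewrite -scalemxAr mulmxBr (PF (x + s *: (P *m y))) (PF x) (FPB (x + _)) (FPB x).
rewrite !mulmxDr -!scalemxAr mulmxA PP.
move: (B *m x) (B *m y) (P *m _) (P *m _) => a b c d.
by apply/colP => i; rewrite !mxE; field.
Qed.

Lemma outer_mulmx e x : e *m e^T *m x = dotv e x *: e.
Proof.
rewrite -mulmxA (_ : e^T *m x = (dotv e x)%:M) ?mul_mx_scalar //.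
apply/matrixP => i j; rewrite !ord1 !mxE mulr1n.
by apply: eq_bigr => k _; rewrite mxE.
Qed.

Lemma splits_family K P B : zoom_family K -> P *m P = P -> P *m B = 0 ->
  K `&` splits P B !=set0 -> zoom_family (K `&` splits P B).
Proof.
move=> [clK _ KN Kz] PP PB K0; split => //.
- by apply: closedI => //; exact: closed_splits.
- by move=> F [/KN].
- by move=> F x s [KF FPB] s0; split; [exact: Kz | apply: zoom_splits; rewrite ?gt_eqF].
Qed.

(** Maximal curvature at [e] makes the projected gradient equal to [t L e] on the segment from [0]
    to [e]; zooming at its midpoint with scales tending to [0] stretches the segment to the whole
    line. *)
Lemma line_maximizer K P : zoom_family K -> P^T = P -> P *m P = P -> P != 0 ->
  exists F e L, [/\ K F, dotv e e = 1, P *m e = e & 0 <= L] /\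
    [/\ convex_smooth L (fun x => F.1 (P *m x)) (fun x => P *m F.2 (P *m x)) &
        forall t, P *m F.2 (P *m (t *: e)) = (t * L) *: e].
Proof.
move=> KK Pt PP Pn0; have [clK _ KN Kz] := KK.
have [F [e [L [[KF e1 Pe L0 Fe] KL]]]] := family_max_curvature KK PP Pn0.
pose z s : jet := zoom (2^-1 *: e) s F.
have zK : (z @ 0^'+) K.
  have : \forall s \near 0^'+, 0 < s :> R by exact: nbhs_right_gt.
  by apply: filterS => s; exact: Kz.
have [G [KG Gz]] := compact_sub_normalized clK KN _ zK.
exists G, e, L; split=> //; split; first exact: (projection_convex_smooth KK).
move=> t; rewrite -scalemxAr Pe; apply: dotv_inj => w.
pose C := [set G : jet | dotv (G.2 (t *: e)) (P *m w) = dotv ((t * L) *: e) w].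
suff : C G by rewrite /C /= dotv_mulmxl Pt.
apply: (cluster_sub_closed _ _ Gz).
  by apply: closed_eqr_fun; [exact: jet_dotv_continuous | exact: cst_continuous].
(* For scales [s] below this value, [1 / 2] and [1 / 2 + s t] both lie in [[0, 1]], where the
   gradient is known. *)
have t0 : 0 < (2 * (`|t| + 1))^-1 :> R.
  by rewrite invr_gt0 mulr_gt0 // ltr_wpDl.
have seg := projection_convex_smooth KK Pt PP L0 KL KF.
have [_ F10 F20] := KN _ KF.
have FP u : 0 <= u <= 1 -> P *m F.2 (u *: e) = (u * L) *: e.
  have := @convex_smooth_segment _ _ _ _ _ e L0 seg.
  rewrite !mulmx0 F10 F20 Pe mulmx0 => /(_ erefl erefl e1 Fe u) H /H.
  by rewrite -scalemxAr Pe.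
suff zC : \forall s \near 0^'+, C (z s) by exact: zC.
near=> s.
have s0 : 0 < s by near: s; exact: nbhs_right_gt.
have st : s < (2 * (`|t| + 1))^-1 by near: s; exact: nbhs_right_lt.
have /andP[ts1 ts2] : - 2^-1 <= s * t <= 2^-1.
  rewrite -ler_norml normrM gtr0_norm //.
  move: st; rewrite -[_^-1]mul1r ltr_pdivlMr ?mulr_gt0 ?ltr_wpDl //.
  by have := normr_ge0 t; nra.
rewrite /C /= -[P in P *m w]Pt -dotv_mulmxl -scalemxAr mulmxBr scalerA -scalerDl.
rewrite !FP; [|lra|lra].
by rewrite -scalerBl scalerA; congr (dotv (_ *: _) _); field; rewrite gt_eqF.
Unshelve. all: by end_near. Qed.

(** By [convex_smooth_line], the projected gradient splits off [L <., e> e], so the direction [e]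
    moves from the unresolved part [P] to the linear part [B]. *)
Lemma splits_step K P B : zoom_family K -> P^T = P -> P *m P = P -> P *m B = 0 ->
  P != 0 -> K `&` splits P B !=set0 ->
  exists e L, [/\ dotv e e = 1, P *m e = e &
    K `&` splits (P - e *m e^T) (B + L *: (e *m e^T)) !=set0].
Proof.
move=> KK Pt PP PB Pn0 K0.
have [G [e [L [[[KG GPB] e1 Pe L0] [Gs Gl]]]]] :=
  line_maximizer (splits_family KK PP PB K0) Pt PP Pn0.
exists e, L; split=> //; exists G; split=> // x.
have [dote linee] := convex_smooth_line L0 Gs e1 Gl.
have P'E u : (P - e *m e^T) *m u = P *m u - dotv e u *: e.
  by rewrite mulmxBl outer_mulmx.
rewrite mulmxDl -scalemxAl outer_mulmx !P'E.
(* Orthogonal decomposition [P x = y + c e], with [y] fixed by [P]. *)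
set c := dotv e x; set y := P *m x - c *: e.
have Py : P *m y = y by rewrite /y mulmxBr mulmxA PP -scalemxAr Pe.
have Px : P *m x = P *m (y + c *: e) by rewrite mulmxDr Py -scalemxAr Pe subrK.
have ye : dotv y e = 0.
  by rewrite /y !dotvE e1 dotv_mulmxl Pt Pe dotvC mulr1 subrr.
have := dote y; rewrite /= ye mulr0 Py dotv_mulmxl Pt Pe => Gye.
rewrite (dotvC e (G.2 y)) Gye scale0r subr0.
have := linee y c; rewrite /= -Px Py => Gx.
by rewrite GPB Gx scalerA (mulrC L) addrA addrAC.
Qed.

(** The row space shrinks strictly: [P] fixes [e], while every left multiple of [P - e e^T]
    annihilates it. *)
Lemma rank_projection_drop P e : P^T = P -> P *m P = P -> P *m e = e -> dotv e e = 1 ->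
  (\rank (P - e *m e^T)%R < \rank P)%N.
Proof.
move=> Pt PP Pe e1; have eP : e^T *m P = e^T by rewrite -{1}Pt -trmx_mul Pe.
apply: rank_ltmx; rewrite /ltmx; apply/andP; split.
  by apply/submxP; exists (P - e *m e^T); rewrite mulmxBl PP -mulmxA eP.
apply/negP => /submxP[X XP].
have : P *m e = X *m ((P - e *m e^T) *m e) by rewrite mulmxA -XP.
rewrite Pe mulmxBl Pe outer_mulmx e1 scale1r subrr mulmx0 => e0.
by move: e1; rewrite e0 dotv0l => /eqP; rewrite eq_sym oner_eq0.
Qed.

(* Peeling off one direction of maximal curvature at a time exhausts the whole space. *)
Lemma zoom_family_linear K : zoom_family K ->
  exists B, B^T = B /\ exists2 F, K F & forall x, F.2 x = B *m x.
Proof.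
move=> KK.
(* Start from [P = I], [B = 0] and lower the rank of [P] until [P = 0]; the invariant [P B = 0] lets
   zooms preserve the splitting. *)
suff peel k P B : (\rank P < k)%N -> P^T = P -> P *m P = P -> P *m B = 0 -> B^T = B ->
    K `&` splits P B !=set0 ->
    exists B', B'^T = B' /\ exists2 F, K F & forall x, F.2 x = B' *m x.
  have [_ [F KF] _ _] := KK.
  apply: (peel n.+1 1%:M 0); rewrite ?mulmx0 ?mulmx1 ?trmx1 ?trmx0 //.
    by rewrite ltnS rank_leq_row.
  by exists F; split=> // x; rewrite mul0mx add0r !mul1mx.
elim: k P B => // k IH P B rP Pt PP PB Bt K0.
have [P0|Pn0] := eqVneq P 0.
  exists B; split=> //; have [F [KF FPB]] := K0; exists F => // x.
  by rewrite FPB P0 mul0mx addr0.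
have [e [L [e1 Pe K1]]] := splits_step KK Pt PP PB Pn0 K0.
have eP : e^T *m P = e^T by rewrite -{1}Pt -trmx_mul Pe.
have eB : e^T *m B = 0 by rewrite -eP -mulmxA PB mulmx0.
have ee : e^T *m e = 1%:M.
  apply/matrixP => i j; rewrite !ord1 mxE -[RHS](_ : dotv e e = _); last first.
    by rewrite e1 mxE.
  by apply: eq_bigr => l _; rewrite mxE.
have EE : e *m e^T *m (e *m e^T) = e *m e^T.
  by rewrite mulmxA -(mulmxA e) ee mulmx1.
apply: (IH _ _ _ _ _ _ _ K1).
- exact: leq_trans (rank_projection_drop Pt PP Pe e1) rP.
- by rewrite linearB /= Pt trmx_mul trmxK.
- by rewrite mulmxBl !mulmxBr PP EE mulmxA Pe -(mulmxA e) eP subrr subr0.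
- rewrite mulmxBl !mulmxDr PB -!scalemxAr EE -(mulmxA e) eB mulmx0 mulmxA Pe.
  by rewrite !add0r subrr.
- by rewrite linearD linearZ /= Bt trmx_mul trmxK.
Qed.

End ZoomFamilies.

(** * Blow-up limits of a convex function with 1-Lipschitz gradient *)

Section BlowUp.
Variables (R : realType) (n : nat).
Notation V := 'cV[R]_n.
Notation jet := (jet R n).
Variables (F : jet) (z0 : V).
Hypothesis Fs : convex_smooth 1 F.1 F.2.

(** Centres vary together with scales, because zooming into a zoom at [z] moves its centre to
    [z + r x]. *)
Let zooms (d : R) : set jet :=
  [set G | exists z r, [/\ enorm (z - z0) < d, 0 < r < d & G = zoom z r F]].

Let blowup_filter : set_system jet := filter_from [set d | 0 < d] zooms.

Let blowup_filter_proper : ProperFilter blowup_filter.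
Proof.
apply: filter_from_proper; first apply: filter_from_filter.
- by exists 1 => /=.
- move=> a b a0 b0; exists (Num.min a b); first by rewrite /= lt_min a0 b0.
  move=> G [z [r [zd /andP[r0 rd] ->]]].
  move: zd rd; rewrite !lt_min => /andP[? ?] /andP[? ?].
  by split; exists z, r; split=> //; apply/andP.
- move=> d d0; exists (zoom z0 (d / 2) F); exists z0, (d / 2).
  by rewrite subrr enorm0; split=> //; have : 0 < d := d0; lra.
Qed.

Let zooms_normalized d : zooms d `<=` @normalized R n.
Proof. by move=> G [z [r [_ /andP[r0 _] ->]]]; exact: zoom_normalized. Qed.

Lemma closed_normalized : closed (@normalized R n).
Proof.
rewrite (_ : @normalized R n = (\bigcap_(xh in [set: V * V])
    ([set G : jet | dotv (G.2 xh.1) xh.2 <= G.1 (xh.1 + xh.2) - G.1 xh.1] `&`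
     [set G : jet | G.1 (xh.1 + xh.2) - G.1 xh.1 - dotv (G.2 xh.1) xh.2
                    <= 1 / 2 * dotv xh.2 xh.2])) `&`
  ([set G : jet | G.1 0 = 0] `&` \bigcap_(w in [set: V]) [set G : jet | dotv (G.2 0) w = 0])).
  apply: closedI; last first.
    apply: closedI.
      by apply: closed_eqr_fun; [exact: jet_value_continuous | exact: cst_continuous].
    apply: closed_bigI => w _.
    by apply: closed_eqr_fun; [exact: jet_dotv_continuous | exact: cst_continuous].
  apply: closed_bigI => -[x h] _ /=.
  have cv := @continuous_subr R jet R^o _ _ (@jet_value_continuous R n (x + h))
    (@jet_value_continuous R n x).
  have cd := @jet_dotv_continuous R n x h.
  apply: closedI; first exact: closed_ler_fun.
  apply: (closed_ler_fun _ (@cst_continuous _ _ _)).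
  exact: (@continuous_subr R jet R^o _ _ cv cd).
apply/seteqP; split => G.
  move=> [Gs G0 p0]; split; last by split=> // w _ /=; rewrite p0 dotv0l.
  move=> [x h] _ /=; have /andP[lo up] := Gs x h; split => //.
  by rewrite -subr_ge0.
move=> [Gs [G0 p0]]; split=> //; last first.
  by apply: dotv_inj => w; rewrite dotv0l; exact: p0.
move=> x h; have [/= lo up] := Gs (x, h) I.
by apply/andP; split; first by rewrite subr_ge0.
Qed.

(** Compactness of the normalized jets provides a cluster point; stability combines continuity of
    [zoom x s] with the composition rule. *)
Lemma blowup_zoom_family : zoom_family (cluster blowup_filter).
Proof.
have FN : blowup_filter (@normalized R n).
  by exists 1; [exact: ltr01 | exact: zooms_normalized].
have clN := closed_normalized.
split; first exact: closed_cluster.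
- by have [G [_ ?]] := compact_sub_normalized clN (@subset_refl _ _)
      blowup_filter_proper FN; exists G.
- exact: cluster_sub_closed.
move=> G x s KG s0 A B [d /= d0 dA] /zoom_continuous GB.
(* Makes [r |x|] and [|z - z0|] smaller than [d / 2], and [r s] smaller than [d]. *)
pose d' := Num.min (d / (2 * (enorm x + 1))) (Num.min (d / 2) (d / s)).
have x1 : 0 < 2 * (enorm x + 1) by rewrite mulr_gt0 // ltr_wpDl ?enorm_ge0.
have d'0 : 0 < d' by rewrite !lt_min !divr_gt0.
have [_ [[z [r [zz /andP[r0 rd] ->]]] zB]] :
    zooms d' `&` (zoom x s @^-1` B) !=set0.
  by apply: KG GB; exists d'.
exists (zoom x s (zoom z r F)); split=> //; apply: dA.
rewrite zoom_zoom ?gt_eqF //; exists (z + r *: x), (r * s).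
move: zz rd; rewrite !lt_min => /and3P[_ zd _] /and3P[rx _ rs].
split=> //; last by rewrite mulr_gt0 //= -ltr_pdivlMr.
rewrite addrAC (le_lt_trans (enormD _ _)) // enormZ gtr0_norm //.
move: rx; rewrite ltr_pdivlMr // => rx.
by have := enorm_ge0 x; lra.
Qed.

Lemma near_jet_gradient (G : jet) (x : V) (eps : R) : 0 < eps ->
  \forall H \near G, enorm (H.2 x - G.2 x) < eps.
Proof.
move=> e0; have cG := @jet_gradient_continuous R n x G.
exact: (cG _ (near_enorm (G.2 x) e0)).
Qed.

(** The linear limit is only pointwise, but gradients of normalized jets are 1-Lipschitz, so
    closeness is uniform on the compact unit ball. The bound on [B] is cocoercivity of the limit. *)
Lemma smooth_blowup : exists B : 'M[R]_n,
  [/\ B^T = B, forall x, dotv (B *m x) (B *m x) <= dotv (B *m x) x &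
   forall eps, 0 < eps -> exists z r, [/\ enorm (z - z0) < eps, 0 < r < eps &
     forall w, enorm w <= 1 ->
       enorm (F.2 (z + r *: w) - F.2 z - r *: (B *m w)) <= eps * r]].
Proof.
have [B [Bt [G KG GB]]] := zoom_family_linear blowup_zoom_family.
have [_ _ KN _] := blowup_zoom_family.
have GN := KN _ KG; exists B; split => //.
  move=> x; have [Gs _ _] := GN; have := convex_smooth_cocoercive ler01 Gs 0 x.
  by rewrite !GB mulmx0 !subr0 mul1r.
move=> eps e0; have e3 : 0 < eps / 3 by lra.
have /compact_near_coveringP cov := @compact_cball R n 1.
have : \forall H \near within (@normalized R n) (nbhs G),
    [set w | enorm w <= 1] `<=` [set w | enorm (H.2 w - G.2 w) < eps].
  apply: (cov _ _ (fun (H : jet) w => enorm (H.2 w - G.2 w) < eps)) => x _.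
  exists ([set w | enorm (w - x) < eps / 3],
          [set H | normalized H /\ enorm (H.2 x - G.2 x) < eps / 3]).
    split; first exact: near_enorm.
    by apply: filterS (near_jet_gradient G x e3) => H.
  move=> [w H] [/= wx [HN Hx]].
  have := normalized_lipschitz x w HN; have := normalized_lipschitz w x GN.
  rewrite (enorm_distC x w).
  have := enorm_triangle (H.2 x) (H.2 w) (G.2 w).
  have := enorm_triangle (G.2 x) (H.2 x) (G.2 w).
  lra.
move=> GH.
have bzooms : blowup_filter (zooms eps) by exists eps.
have [_ [[z [r [zz /andP[r0 re] ->]]] zG]] := KG _ _ bzooms GH.
exists z, r; split=> //; first by rewrite r0.
move=> w w1; have := zG (zoom_normalized z r0 Fs) w w1.
rewrite /= GB => H.
have -> : F.2 (z + r *: w) - F.2 z - r *: (B *m w)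
    = r *: (r^-1 *: (F.2 (z + r *: w) - F.2 z) - B *m w).
  by rewrite scalerBr scalerA divff ?gt_eqF // scale1r.
by rewrite enormZ gtr0_norm // mulrC ler_pM2r // ltW.
Qed.

End BlowUp.

(** * The proximal map of [q] *)

Section Prox.
Variables (R : realType) (n : nat) (q : 'cV[R]_n -> \bar R).
Notation V := 'cV[R]_n.
Implicit Types (x y z p u v w : V).

Lemma subdiff_fine p u p' u' : subdiff q p u -> subdiff q p' u' ->
  fine (q p) + dotv u (p' - p) <= fine (q p').
Proof.
move=> [qp sub] [qp' _]; have := sub p'.
by rewrite -{1}(fineK qp) -{1}(fineK qp') -EFinD lee_fin.
Qed.

Hypotheses (qproper : proper_fun q) (qconvex : convex_fun q) (qlsc : lsc_fun q).

Lemma prox_objective_lsc z a x : (a%:E < q x + (1 / 2 * dotv (x - z) (x - z))%:E)%E ->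
  \forall y \near x, (a%:E < q y + (1 / 2 * dotv (y - z) (y - z))%:E)%E.
Proof.
set b := 1 / 2 * dotv (x - z) (x - z) => ax.
have [a1 aa1 a1q] : exists2 a1 : R, a - b < a1 & (a1%:E < q x)%E.
  move: ax; case: (q x) => [c| |] //; last by exists (a - b + 1); rewrite ?ltry ?ltrDl.
  rewrite -EFinD lte_fin => ac; have ac' : a - b < c by lra.
  by have [? ?] := midf_lt ac'; exists ((a - b + c) / 2); rewrite ?lte_fin.
have [d [d0 dq]] := qlsc a1q.
have C0 : 0 < enorm (x - z) + 1 by rewrite ltr_wpDl ?enorm_ge0.
apply: (@near_dist_enorm _ _ _ _ (Num.min d ((a1 - (a - b)) / (enorm (x - z) + 1)))).
  by rewrite lt_min d0 divr_gt0 // subr_gt0.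
move=> y; rewrite lt_min ltr_pdivlMr // => /andP[yd yC].
have := dq y yd; move: (q y) => [c| |] //; last by move=> _; rewrite addye // ltry.
rewrite -EFinD !lte_fin => a1c.
have -> : y - z = (x - z) + (y - x) by rewrite (addrC (x - z)) subrKA.
have := dotvv_ge0 (y - x).
have := normr_dotv (x - z) (y - x); rewrite ler_norml => /andP[cs _].
move: cs yC; rewrite dotvvD; set D := dotv (x - z) (y - x).
have := enorm_ge0 (y - x); rewrite /b; set r := enorm (y - x); set m := enorm _.
lra.
Qed.

(** The point [p] minimizes [q + |. - z|^2 / 2]; the subgradient [xs] reduces the problem to a ball,
    and convexity along segments from [p] gives the optimality condition. *)
Lemma prox_exists x xs z : subdiff q x xs -> exists p, subdiff q p (z - p).
Proof.
move=> [qx sub]; pose h y := (q y + (1 / 2 * dotv (y - z) (y - z))%:E)%E.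
(* Beyond this distance from [x], the lower bound [<xs + x - z, y - x> + |y - x|^2 / 2] for the
   increase of the objective is nonnegative. *)
pose rho := 2 * enorm (xs + x - z).
have rho0 : 0 <= rho by rewrite mulr_ge0 ?enorm_ge0.
have ball0 : [set d : V | enorm d <= rho] !=set0 by exists 0; rewrite /= enorm0.
have := compact_attains_min (h := fun d => h (x + d)) (@compact_cball R n rho) ball0.
case=> [d a _ /prox_objective_lsc ad | d /= drho dmin].
  have cd : continuous (fun d : V => x + d).
    by move=> u; exact: (@cvgD _ _ _ (nbhs u) _ (fun=> x) id x u (cvg_cst x) cvg_id).
  by apply: (@filterS _ (nbhs d) _ _ _ _ (cd d _ ad)) => y ay _; exact: ay.
have {dmin} dmin y : (h (x + d)%R <= h y)%E.
  have [yin|yout] := leP (enorm (y - x)) rho.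
    by have := dmin (y - x) yin; rewrite (addrC x (y - x)) subrK.
  have := dmin 0; rewrite enorm0 addr0 => /(_ rho0) /le_trans; apply.
  have := sub y; rewrite /h -(fineK qx); case: (q y) => [c| |] //; last first.
    by move=> _; rewrite addye // leey.
  rewrite -!EFinD !lee_fin => lo.
  have E : y - z = (x - z) + (y - x) by rewrite (addrC (x - z)) subrKA.
  have := normr_dotv (xs + x - z) (y - x); rewrite ler_norml => /andP[cs _].
  move: cs lo; rewrite E -addrA.
  move: yout; rewrite /rho -addrA; set D := y - x; set Z := x - z.
  rewrite dotvvD -(sqr_enorm D) dotvDl => yout cs lo.
  have : 0 <= enorm D * (enorm D - 2 * enorm (xs + Z)).
    by rewrite mulr_ge0 ?enorm_ge0 // subr_ge0 ltW.
  move: cs lo; set a := enorm D; set b := enorm _; lra.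
set p := x + d in dmin; exists p.
have qp : q p \is a fin_num.
  rewrite fin_numE qproper.1 /=; apply/eqP => qpoo.
  by have := dmin x; rewrite /h qpoo -(fineK qx) addye // -EFinD leye_eq.
split=> // y; have [qyoo|qyoo] := eqVneq (q y) +oo%E; first by rewrite qyoo leey.
have qy : q y \is a fin_num by rewrite fin_numE qproper.1.
rewrite -(fineK qp) -(fineK qy) -EFinD lee_fin.
set Q := fine (q p); set Y := fine (q y).
pose c := dotv (p - z) (y - p); pose D := dotv (y - p) (y - p).
(* Comparing [p] with [t y + (1 - t) p] and dividing by [t] leaves an error of order [t]. *)
have ineq t : 0 < t <= 1 -> Q - Y - c <= t / 2 * D.
  move=> /andP[t0 t1]; have := dmin (t *: y + (1 - t) *: p).
  have cv := qconvex y p (_ : 0 <= t <= 1); rewrite (ltW t0) t1 in cv.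
  move=> lo; have := le_trans lo (leeD2r _ (cv erefl)).
  rewrite /h -(fineK qp) -(fineK qy) -!EFinM -!EFinD lee_fin -/Q -/Y.
  have -> : t *: y + (1 - t) *: p - z = (p - z) + t *: (y - p).
    by apply/colP => i; rewrite !mxE; ring.
  rewrite (dotvvD (p - z)) !dotvZl !dotvZr -/c -/D => H.
  by rewrite -(ler_pM2l t0); lra.
have D0 : 0 <= D by exact: dotvv_ge0.
suff : Q - Y - c <= 0.
  by rewrite /c -(opprB z p) dotvNl; lra.
apply/ler_addgt0Pr => e e0; rewrite add0r.
pose t := Num.min 1 (e / (D + 1)).
have D1 : 0 < D + 1 by lra.
have t0 : 0 < t by rewrite lt_min ltr01 divr_gt0.
have t1 : t <= 1 by rewrite ge_min lexx.
have te : t * (D + 1) <= e by rewrite -ler_pdivlMr // ge_min lexx orbT.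
by apply: le_trans (ineq t _) _; rewrite ?t0 //; nra.
Qed.

Variables (P : V -> V).
Hypothesis prox : forall z, subdiff q (P z) (z - P z).

(** By monotonicity, two points of the graph with the same sum of components coincide. *)
Lemma prox_subdiff a b : subdiff q a b -> P (a + b) = a.
Proof.
move=> ab; apply/eqP; rewrite -subr_eq0 -dotvv_eq0 eq_le dotvv_ge0 andbT.
have := subdiff_fine ab (prox (a + b)); have := subdiff_fine (prox (a + b)) ab.
set p := P _; rewrite !dotvE (dotvC p a); lra.
Qed.

(** The function is [|z|^2 / 2] minus the Moreau envelope of [q]; the bounds come from the
    subgradient inequalities between [P x] and [P (x + h)]. *)
Lemma prox_convex_smooth :
  convex_smooth 1 (fun z => dotv z (P z) - 1 / 2 * dotv (P z) (P z) - fine (q (P z))) P.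
Proof.
move=> x h; have := subdiff_fine (prox x) (prox (x + h)).
have := subdiff_fine (prox (x + h)) (prox x).
have := dotvv_ge0 (P (x + h) - P x).
have := dotvv_ge0 (h - (P (x + h) - P x)).
set p := P x; set p' := P (x + h); set Q := fine _; set Q' := fine _.
rewrite !dotvE (dotvC p' p) (dotvC h p) (dotvC h p') => h1 h2 h3 h4.
by apply/andP; split; lra.
Qed.

Lemma prox_nonexpansive x y : enorm (P y - P x) <= enorm (y - x).
Proof.
(* Zooming at [0] with scale [1] only subtracts an affine function and leaves differences of [P]
   unchanged. *)
have N := zoom_normalized 0 ltr01 (F := (_, P)) prox_convex_smooth.
have := normalized_lipschitz x y N => /=.
by rewrite invr1 !scale1r !add0r opprB addrA subrK.
Qed.

End Prox.

(** * Norms and convergence of pairs, maxima on balls *)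

Section Pairs.
Variables (R : realType) (n : nat).
Notation V := 'cV[R]_n.
Implicit Types z w : V * V.

Lemma enorm2_le z : enorm2 z <= enorm z.1 + enorm z.2.
Proof.
rewrite -(ler_sqr (sqrtr_ge0 _)) ?nnegrE ?addr_ge0 ?enorm_ge0 //.
rewrite sqr_sqrtr ?addr_ge0 ?dotvv_ge0 // /dot2 -!sqr_enorm sqrrD.
have := mulr_ge0 (enorm_ge0 z.1) (enorm_ge0 z.2); lra.
Qed.

Lemma enorm_fst z : enorm z.1 <= enorm2 z.
Proof. by rewrite ler_wsqrtr // lerDl dotvv_ge0. Qed.

Lemma enorm_snd z : enorm z.2 <= enorm2 z.
Proof. by rewrite ler_wsqrtr // lerDr dotvv_ge0. Qed.

Lemma cvg2_harmonic (u : nat -> V * V) z (C : R) : 0 < C ->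
  (forall k, enorm2 (u k - z) <= C / k.+1%:R) -> cvg2 u z.
Proof.
move=> C0 uz e e0; exists (Num.truncn (C / e)) => k Nk.
apply: (le_lt_trans (uz k)); rewrite ltr_pdivrMr // mulrC -ltr_pdivrMr //.
by apply: (lt_le_trans (truncnS_gt _)); rewrite ler_nat.
Qed.

(** The one-sided Lipschitz bound at each point yields upper semicontinuity. *)
Lemma cball_attains_max (f : V -> R) (r : R) : 0 <= r ->
  (forall x, exists C, forall y, f y <= f x + C * enorm (y - x)) ->
  exists2 x, enorm x <= r & forall y, enorm y <= r -> f y <= f x.
Proof.
move=> r0 fC.
have ball0 : [set d : V | enorm d <= r] !=set0 by exists 0; rewrite /= enorm0.
have := compact_attains_min (h := fun x => (- f x)%:E) (@compact_cball R n r) ball0.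
case=> [x a _ | x xr xmin]; last first.
  by exists x => // y yr; have := xmin y yr; rewrite lee_fin lerN2.
rewrite lte_fin => ax; have [C fx] := fC x.
have C0 : 0 < `|C| + 1 by rewrite ltr_wpDl.
apply: (@near_dist_enorm _ _ _ _ ((- f x - a) / (`|C| + 1))).
  by rewrite divr_gt0 // subr_gt0.
move=> y; rewrite ltr_pdivlMr // => yx _; rewrite lte_fin.
have := fx y; have := ler_norm C; have := enorm_ge0 (y - x).
set d := enorm _ in yx *; nra.
Qed.

End Pairs.

(** * Regular normals to the graph of the subdifferential *)

Section Normals.
Variables (R : realType) (n : nat) (q : 'cV[R]_n -> \bar R).
Notation V := 'cV[R]_n.
Variable P : V -> V.
Hypothesis prox : forall z, subdiff q (P z) (z - P z).

(** A step [s] in an approximate tangent direction [(a', b')] moves [y] by [s c], with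
    [c = a' + b'], and [P y] by [s a']. Maximality at [y] then bounds the pairing of the candidate
    normal with [(a', b')] by [m s |c|^2], which vanishes in the limit. *)
Lemma prox_regular_normal (B : 'M[R]_n) (v z y : V) (m rho : R) :
  B^T = B -> 0 <= m -> 0 < rho ->
  (forall y', enorm (y' - y) < rho ->
     dotv v (P y' - B *m y') - m * dotv (y' - z) (y' - z) <=
     dotv v (P y - B *m y) - m * dotv (y - z) (y - z)) ->
  regular_normal_cone (gph (subdiff q)) (P y, y - P y)
    (v - B *m v - (2 * m) *: (y - z), - (B *m v) - (2 * m) *: (y - z)).
Proof.
move=> Bt m0 rho0 ymax [a b] [t [wk [t0 [tcvg [wcvg wC]]]]].
set N := (_, _); apply/ler_addgt0Pr => eta eta0; rewrite add0r.
pose M := enorm a + enorm b + 2.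
have M0 : 0 < M by rewrite /M; have := enorm_ge0 a; have := enorm_ge0 b; lra.
have N0 : 0 < enorm N.1 + enorm N.2 + 1.
  by rewrite ltr_wpDl ?addr_ge0 ?enorm_ge0.
(* With [e1], [|a' + b'| <= M] and replacing [(a', b')] by [(a, b)] costs at most [eta / 2]; [e2]
   keeps the moved point within [rho] of [y] and the second-order term below [eta / 2]. *)
pose e1 := Num.min 1 (eta / 2 / (enorm N.1 + enorm N.2 + 1)).
pose e2 := Num.min (rho / M) (eta / 2 / (m * M ^+ 2 + 1)).
have mM : 0 < m * M ^+ 2 + 1 by have := mulr_ge0 m0 (sqr_ge0 M); lra.
have e10 : 0 < e1 by rewrite lt_min ltr01 divr_gt0 // divr_gt0.
have e20 : 0 < e2 by rewrite lt_min !divr_gt0.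
have [k1 wk1] := wcvg e1 e10; have [k2 tk2] := tcvg e2 e20.
pose k := maxn k1 k2.
have := wk1 k (leq_maxl _ _); have := tk2 k (leq_maxr _ _).
have := wC k; have := t0 k; rewrite subr0.
case: (wk k) => a' b'; move: (t k) => s s0 subk.
rewrite gtr0_norm // !lt_min ltr_pdivlMr // ltr_pdivlMr // => /andP[sM sm].
rewrite ltr_pdivlMr // => /andP[w1 wN].
pose c := a' + b'.
have aa : enorm (a' - a) <= enorm2 ((a', b') - (a, b)) by exact: (enorm_fst ((a', b') - (a, b))).
have bb : enorm (b' - b) <= enorm2 ((a', b') - (a, b)) by exact: (enorm_snd ((a', b') - (a, b))).
have cM : enorm c <= M.
  rewrite /M (le_trans (enormD _ _)) //.
  have := enormD (a' - a) a; have := enormD (b' - b) b; rewrite !subrK; lra.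
have c2M : dotv c c <= M ^+ 2 by rewrite -enorm_le // ltW.
have Ps : P (y + s *: c) = P y + s *: a'.
  rewrite -[RHS]/(((P y, y - P y) + s *: (a', b')).1) -(prox_subdiff prox subk).
  congr P.
  by apply/colP => i; rewrite !mxE; ring.
have := ymax (y + s *: c); rewrite Ps.
have -> : y + s *: c - y = s *: c by rewrite addrC addKr.
have sc : s * enorm c < rho by apply: le_lt_trans sM; rewrite ler_pM2l.
rewrite enormZ gtr0_norm // => /(_ sc).
have -> : y + s *: c - z = (y - z) + s *: c by rewrite addrAC.
have -> : P y + s *: a' - B *m (y + s *: c) = (P y - B *m y) + s *: (a' - B *m c).
  by rewrite mulmxDr -scalemxAr; apply/colP => i; rewrite !mxE; ring.
rewrite (dotvvD (y - z)) !(dotvDr (P y - B *m y)) !dotvZl !dotvZr => ineq.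
have {ineq} ineq : dotv v (a' - B *m c) - 2 * m * dotv (y - z) c <= m * s * dotv c c.
  by rewrite -(ler_pM2l s0); lra.
have Nk : dot2 N (a', b') = dotv v (a' - B *m c) - 2 * m * dotv (y - z) c.
  by rewrite /dot2 /N /= /c mulmxDr !dotvE !dotv_mulmxl Bt; ring.
have Nab : dot2 N (a, b) <= dot2 N (a', b') +
    (enorm N.1 + enorm N.2) * enorm2 ((a', b') - (a, b)).
  case: (N) => N1 N2; rewrite /dot2 /=.
  have := dotv_le_enorm N1 (a - a'); have := dotv_le_enorm N2 (b - b').
  rewrite !(enorm_distC a) !(enorm_distC b) !dotvDr !dotvNr.
  have := ler_wpM2l (enorm_ge0 N1) aa; have := ler_wpM2l (enorm_ge0 N2) bb.
  lra.
rewrite (le_trans Nab) // Nk.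
have : m * s * dotv c c <= eta / 2.
  apply: (@le_trans _ _ (s * (m * M ^+ 2 + 1))); last exact: ltW.
  rewrite mulrDr mulr1 (mulrC m) -mulrA.
  have : m * dotv c c <= m * M ^+ 2 by rewrite ler_wpM2l.
  by rewrite -(ler_pM2l s0); lra.
have : (enorm N.1 + enorm N.2) * enorm2 ((a', b') - (a, b)) <= eta / 2.
  rewrite (le_trans _ (ltW wN)) // mulrC ler_wpM2l ?sqrtr_ge0 //; lra.
lra.
Qed.

End Normals.

(** * From a linear blow-up to limiting normals *)

Section Coderivative.
Variables (R : realType) (n : nat) (q : 'cV[R]_n -> \bar R).
Notation V := 'cV[R]_n.
Variables (P : V -> V) (B : 'M[R]_n) (z0 : V).
Hypotheses (prox : forall z, subdiff q (P z) (z - P z))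
  (Plip : forall x y, enorm (P y - P x) <= enorm (y - x))
  (Bt : B^T = B) (Blip : forall x, enorm (B *m x) <= enorm x)
  (Bapprox : forall eps, 0 < eps -> exists z r, [/\ enorm (z - z0) < eps, 0 < r < eps &
     forall w, enorm w <= 1 ->
       enorm (P (z + r *: w) - P z - r *: (B *m w)) <= eps * r]).

(** A maximizer [w] of [psi] interior to the unit ball makes [y = z + r w] a local maximizer with
    penalty weight [m = eps / r]; the resulting normal misses the target by [2 eps w] in each
    component. *)
Lemma near_regular_normal (v : V) (eps : R) : 0 < eps ->
  exists y N, [/\ enorm (y - z0) <= 2 * eps,
    regular_normal_cone (gph (subdiff q)) (P y, y - P y) N &
    enorm2 (N - (v - B *m v, - (B *m v))) <= 4 * eps].
Proof.
(* Sized so that [psi w >= psi 0 = 0] forces [|w|^2 <= |v| / (2 (|v| + 1)) < 1]. *)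
move=> e0; pose eta := eps / (2 * (enorm v + 1)).
have v0 := enorm_ge0 v; have v2 : 0 < 2 * (enorm v + 1) by lra.
have eta0 : 0 < eta by rewrite divr_gt0.
have etav : eta * (2 * (enorm v + 1)) = eps by rewrite divfK // gt_eqF.
have [z [r [zz /andP[r0 re] approx]]] := Bapprox eta0.
pose u w := P (z + r *: w) - P z - r *: (B *m w).
pose psi w := dotv v (u w) - eps * r * dotv w w.
have ulip x y : enorm (u y - u x) <= 2 * r * enorm (y - x).
  have -> : u y - u x = (P (z + r *: y) - P (z + r *: x)) - r *: (B *m (y - x)).
    by rewrite mulmxBr; apply/colP => i; rewrite !mxE; ring.
  apply: (le_trans (enormB_le _ _)); rewrite enormZ gtr0_norm //.
  have := Plip (z + r *: x) (z + r *: y).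
  have -> : z + r *: y - (z + r *: x) = r *: (y - x).
    by apply/colP => i; rewrite !mxE; ring.
  rewrite enormZ gtr0_norm //; have := Blip (y - x).
  by rewrite -(ler_pM2l r0); lra.
have [w w1 wmax] : exists2 w, enorm w <= 1 & forall y, enorm y <= 1 -> psi y <= psi w.
  apply: cball_attains_max => // x.
  exists (enorm v * (2 * r) + 2 * (eps * r) * enorm x) => y.
  have := dotv_le_enorm v (u y - u x).
  have := ler_wpM2l v0 (ulip x y); rewrite /psi dotvDr dotvNr.
  have -> : dotv y y = dotv x x + 2 * dotv x (y - x) + dotv (y - x) (y - x).
    by rewrite -dotvvD addrC subrK.
  have er : 0 < eps * r by rewrite mulr_gt0.
  have := mulr_ge0 (ltW er) (dotvv_ge0 (y - x)).
  have := normr_dotv x (y - x); rewrite ler_norml => /andP[xy _].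
  have := ler_wpM2l (ltW er) xy; lra.
have w1' : enorm w < 1.
  rewrite enorm_lt // expr1n.
  have := wmax 0; rewrite enorm0 ler01 /psi /u scaler0 addr0 mulmx0 scaler0.
  rewrite !(subrr, subr0, dotv0r, mulr0) => /(_ isT).
  have := dotv_le_enorm v (u w); have := ler_wpM2l v0 (approx w w1).
  rewrite -/(u w) => h1 h2 h3.
  have h4 : eps * r * dotv w w <= enorm v * (eta * r) by lra.
  have : eta * r * (2 * (enorm v + 1) * dotv w w) <= eta * r * enorm v.
    by move: h4; rewrite -{1}etav; lra.
  rewrite (ler_pM2l (mulr_gt0 eta0 r0)) => h5.
  by have := dotvv_ge0 w; nra.
pose y := z + r *: w.
pose N : V * V := (v - B *m v - (2 * (eps / r)) *: (y - z),
                   - (B *m v) - (2 * (eps / r)) *: (y - z)).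
have yz : y - z = r *: w by rewrite /y addrC addKr.
have re' : eps / r * r = eps by rewrite divfK // gt_eqF.
exists y, N; split.
- have -> : y - z0 = (z - z0) + r *: w by rewrite /y addrAC.
  apply: (le_trans (enormD _ _)); rewrite enormZ gtr0_norm //.
  have : r * enorm w <= r by rewrite ler_piMr // ltW.
  by have : eta <= eps by [rewrite -etav ler_peMr //; lra]; lra.
(* This radius keeps the rescaled point [w'] in the unit ball, where [w] is maximal. *)
- apply: (@prox_regular_normal _ _ _ _ prox _ _ _ _ _ (r * (1 - enorm w))) => //.
  + by rewrite divr_ge0 ?ltW.
  + by rewrite mulr_gt0 // subr_gt0.
  move=> y' y'y; pose w' := r^-1 *: (y' - z).
  have y'E : y' = z + r *: w' by rewrite /w' scalerA divff ?gt_eqF // scale1r addrC subrK.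
  have w'1 : enorm w' <= 1.
    move: y'y; rewrite y'E /y.
    have -> : z + r *: w' - (z + r *: w) = r *: (w' - w).
      by apply/colP => i; rewrite !mxE; ring.
    rewrite enormZ gtr0_norm // ltr_pM2l // => w'w.
    by have := enormD (w' - w) w; rewrite subrK; lra.
  have := wmax w' w'1; rewrite /psi.
  have E x : dotv v (P (z + r *: x) - B *m (z + r *: x))
      - eps / r * dotv (z + r *: x - z) (z + r *: x - z)
      = dotv v (u x) - eps * r * dotv x x + dotv v (P z - B *m z).
    have -> : z + r *: x - z = r *: x by rewrite addrC addKr.
    rewrite mulmxDr -scalemxAr /u !(dotvDr, dotvNr) !(dotvZl, dotvZr).
    by field; rewrite gt_eqF.
  by rewrite y'E /y !E; lra.
- apply: (le_trans (enorm2_le _)); rewrite /N /=.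
  have E x : x - (2 * (eps / r)) *: (y - z) - x = - ((2 * eps) *: w).
    rewrite yz; apply/colP => i; rewrite !mxE; field; by rewrite gt_eqF.
  rewrite !E enormN enormZ gtr0_norm ?mulr_gt0 //.
  have : eps * enorm w <= eps by rewrite ler_piMr // ltW.
  lra.
Qed.

Lemma limiting_normal_of_smooth_blowup (v : V) :
  limiting_normal_cone (gph (subdiff q)) (P z0, z0 - P z0) (v - B *m v, - (B *m v)).
Proof.
have inv0 k : 0 < k.+1%:R^-1 :> R by rewrite invr_gt0 ltr0n.
have /choice[y /choice[N yN]] := fun k => near_regular_normal v (inv0 k).
exists (fun k => (P (y k), y k - P (y k))), N; split; [|split; [|split]].
- by move=> k; exact: prox.
(* The constant is [2 + 4]: as [P] is nonexpansive, the first component contributes [2] and the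
   second, a difference of two such terms, [4]. *)
- apply: (@cvg2_harmonic _ _ _ _ 6) => // k; have [yk _ _] := yN k.
  apply: (le_trans (enorm2_le _)) => /=.
  have -> : y k - P (y k) - (z0 - P z0) = (y k - z0) - (P (y k) - P z0).
    by apply/colP => i; rewrite !mxE; ring.
  have := enormB_le (y k - z0) (P (y k) - P z0); have := Plip z0 (y k).
  by move: yk; move: (k.+1%:R^-1) => i; lra.
- by move=> k; have [] := yN k.
- by apply: (@cvg2_harmonic _ _ _ _ 4) => // k; have [] := yN k.
Qed.

End Coderivative.

(** * The matrix [G = I - B] obtained from the blow-up of the proximal map *)

Theorem theorem3p6 (R : realType) (n : nat) (q : 'cV[R]_n -> \bar R) :
  proper_fun q -> convex_fun q -> lsc_fun q ->
  forall x xs : 'cV[R]_n, subdiff q x xs ->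
  exists G : 'M[R]_n,
    psd G /\ spectral_norm G <= 1 /\
    forall vs : 'cV[R]_n,
      coderivative (subdiff q) x xs ((1%:M - G) *m vs) (G *m vs).
Proof.
move=> qproper qconvex qlsc x xs xxs.
have /choice[P prox] := fun z => prox_exists qproper qconvex qlsc z xxs.
have Psmooth := prox_convex_smooth prox.
(* At [x + xs] the map [P] takes the value [x], so the base point of the normal cone is
   [(x, xs)]. *)
have [B [Bt Bcoco Bapprox]] := smooth_blowup (F := (_, P)) (x + xs) Psmooth.
have Blip u : enorm (B *m u) <= enorm u.
  rewrite enorm_le ?enorm_ge0 // sqr_enorm.
  have := Bcoco u; have := dotvv_ge0 (u - B *m u).
  by rewrite !dotvE (dotvC u); lra.
(* Cocoercivity passes from [B] to [I - B] and yields both positivity and the norm bound. *)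
have Gcoco u : dotv ((1%:M - B) *m u) ((1%:M - B) *m u) <= dotv u ((1%:M - B) *m u).
  rewrite mulmxBl mul1mx !dotvE (dotvC u (B *m u)).
  by have := Bcoco u; lra.
exists (1%:M - B); split; last split.
- split=> [|u]; first by rewrite linearB /= trmx1 Bt.
  by apply: le_trans (Gcoco u); exact: dotvv_ge0.
- apply: ge_sup; first by exists 0, 0; rewrite /= ?enorm0 ?mulmx0 ?enorm0.
  move=> _ [u /= u1 <-]; apply: le_trans u1.
  rewrite enorm_le ?enorm_ge0 // sqr_enorm.
  have := Gcoco u; have := dotvv_ge0 (u - (1%:M - B) *m u).
  by rewrite !dotvE (dotvC u); lra.
move=> vs; have := limiting_normal_of_smooth_blowup prox
  (prox_nonexpansive prox) Bt Blip Bapprox vs.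
rewrite (prox_subdiff prox xxs) (addrC x) addrK /coderivative /=.
have -> : 1%:M - (1%:M - B) = B by rewrite opprB addrC subrK.
by rewrite mulmxBl mul1mx.
Qed.
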